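(* Let $G=G_n(g,f)$ be a Riordan graph with $f'(0)=1$. The reverse relabeling of $G$ (replacing each label $i$ by $n+1-i$, $i\in[n]$) is a Riordan graph, given by $$G'=G_n\left(g(\bar f)\cdot\bar f'\cdot(t/\bar f)^{\,n-1},\ \bar f\right).$$
   Context: $[t^k]u$ is the coefficient of $t^k$ in $u$. For $g,f\in\mathbb{Z}[[t]]$ with $f(0)=0$, the Riordan graph $G_n(g,f)$ is the simple graph on $[n]=\{1,\dots,n\}$ in which, for $i>j\ge1$, $i$ and $j$ are adjacent iff $[t^{i-2}]\,g f^{\,j-1}\equiv 1 \pmod 2$. $\bar f$ denotes the compositional inverse of $f$, i.e. $\bar f(f(t))=f(\bar f(t))=t$, and $\bar f'$ its derivative. *)

(* Defs.v *)
From HB Require Import structures.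
From mathcomp Require Import all_boot all_order all_algebra.
From mathcomp Require Import boolp classical_sets.

Set Implicit Arguments.
Unset Strict Implicit.
Unset Printing Implicit Defensive.

Import GRing.Theory.

Local Open Scope ring_scope.

Record fps (R : Type) := Fps { coefs : nat -> R }.

(* R[[t]]; [coefs u k] is [t^k] u. *)
Notation "{ 'fps' R }" := (fps R) (at level 0, format "{ 'fps'  R }").

Lemma fpsP (R : Type) (u v : {fps R}) : (forall k, coefs u k = coefs v k) <-> u = v.
Proof.
split=> [|->//]; case: u v => [u] [v] /= uv.
by congr Fps; apply/funext.
Qed.

HB.instance Definition _ (R : Type) := gen_eqMixin (fps R).
HB.instance Definition _ (R : Type) := gen_choiceMixin (fps R).

Section FpsRing.
Variable R : comNzRingType.
Implicit Types u v w : {fps R}.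

Definition fps_zero : {fps R} := Fps (fun=> 0).
Definition fps_opp u : {fps R} := Fps (fun k => - coefs u k).
Definition fps_add u v : {fps R} := Fps (fun k => coefs u k + coefs v k).

Fact fps_addA : associative fps_add.
Proof. by move=> u v w; apply/fpsP => k /=; rewrite addrA. Qed.
Fact fps_addC : commutative fps_add.
Proof. by move=> u v; apply/fpsP => k /=; rewrite addrC. Qed.
Fact fps_add0 : left_id fps_zero fps_add.
Proof. by move=> u; apply/fpsP => k /=; rewrite add0r. Qed.
Fact fps_addN : left_inverse fps_zero fps_opp fps_add.
Proof. by move=> u; apply/fpsP => k /=; rewrite addNr. Qed.

HB.instance Definition _ :=
  GRing.isZmodule.Build (fps R) fps_addA fps_addC fps_add0 fps_addN.

Definition fps_one : {fps R} := Fps (fun k => (k == 0%N)%:R).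
Definition fps_mul u v : {fps R} :=
  Fps (fun k => \sum_(i < k.+1) coefs u i * coefs v (k - i)).

Definition fps_trunc N u : {poly R} := \poly_(i < N) coefs u i.

Lemma coef_fps_trunc N u k : (k < N)%N -> (fps_trunc N u)`_k = coefs u k.
Proof. by move=> kN; rewrite coef_poly kN. Qed.

Lemma coefs_mul_trunc N u v k : (k < N)%N ->
  coefs (fps_mul u v) k = (fps_trunc N u * fps_trunc N v)`_k.
Proof.
move=> kN; rewrite coefM; apply: eq_bigr => i _.
have iN : (i < N)%N by apply: leq_ltn_trans kN; rewrite -ltnS.
by rewrite !coef_fps_trunc // (leq_ltn_trans (leq_subr _ _) kN).
Qed.

Fact fps_mulA : associative fps_mul.
Proof.
move=> u v w; apply/fpsP => k.
transitivity (fps_trunc k.+1 u * fps_trunc k.+1 v * fps_trunc k.+1 w)`_k.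
  rewrite -mulrA coefM; apply: eq_bigr => i _.
  have kik : (k - i < k.+1)%N by rewrite ltnS leq_subr.
  by rewrite (coefs_mul_trunc _ _ kik) (coef_fps_trunc _ (ltn_ord i)).
rewrite coefM; apply: eq_bigr => i _.
by rewrite (coefs_mul_trunc _ _ (ltn_ord i)) coef_fps_trunc // ltnS leq_subr.
Qed.

Fact fps_mulC : commutative fps_mul.
Proof. by move=> u v; apply/fpsP => k; rewrite !(coefs_mul_trunc _ _ (ltnSn k)) mulrC. Qed.

Fact fps_mul1 : left_id fps_one fps_mul.
Proof.
move=> u; apply/fpsP => k /=.
by rewrite big_ord_recl /= mul1r subn0 big1 ?addr0 // => i _; rewrite mul0r.
Qed.

Fact fps_mulDl : left_distributive fps_mul fps_add.
Proof.
move=> u v w; apply/fpsP => k /=.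
by rewrite -big_split; apply: eq_bigr => i _; rewrite mulrDl.
Qed.

Fact fps_one_neq0 : fps_one != 0.
Proof. by apply/eqP => /fpsP/(_ 0%N) /eqP; rewrite oner_eq0. Qed.

HB.instance Definition _ := GRing.Zmodule_isComNzRing.Build (fps R)
  fps_mulA fps_mulC fps_mul1 fps_mulDl fps_one_neq0.

Definition fpsX : {fps R} := Fps (fun k => (k == 1%N)%:R).

Definition fps_deriv u : {fps R} := Fps (fun k => coefs u k.+1 *+ k.+1).

(* The composite u(v), meaningful when v(0) = 0: then [t^k] v^i = 0 for i > k,
   so that [t^k] u(v) is the finite sum below. *)
Definition fps_comp u v : {fps R} :=
  Fps (fun k => \sum_(i < k.+1) coefs u i * coefs (v ^+ i) k).

(* The conditions u(0) = v(0) = 0 ensure that both composites make sense. *)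
Definition is_compinv u v : Prop :=
  [/\ coefs u 0 = 0, coefs v 0 = 0, fps_comp v u = fpsX & fps_comp u v = fpsX].

(* The compositional inverse of u, if there is one (it is then unique),
   and 0 otherwise. *)
Definition compinv u : {fps R} := xget 0 [set v | is_compinv u v]%classic.

(* The exact quotient u / v, i.e. the series w with w v = u, if there is one
   (unique when v is not a zero divisor), and 0 otherwise. Here v need not be
   invertible: the quotient t / v is used with v(0) = 0. *)
Definition fps_quo u v : {fps R} := xget 0 [set w | w * v = u]%classic.

End FpsRing.

Record sgraph (V : finType) := SGraph {
  adj : rel V;
  adj_sym : symmetric adj;
  adj_irr : irreflexive adj
}.

Lemma sgraphP (V : finType) (G H : sgraph V) : adj G =2 adj H <-> G = H.
Proof.
split=> [|->//]; case: G H => [e se ie] [e' se' ie'] /= ee'.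
have {}ee' : e = e' by apply/funext => x; apply/funext => y; exact: ee'.
by case: e' / ee' in se' ie' *; congr SGraph; exact: Prop_irrelevance.
Qed.

(* The vertex i : 'I_n stands for the element i.+1 of [n] = {1, ..., n}. *)
Definition label (n : nat) (i : 'I_n) : nat := i.+1.

Section Riordan.
Variables (n : nat) (g f : {fps int}).

(* For labels i > j >= 1 the subtractions i - 2 and j - 1 are exact. *)
Definition riordan_lower (i j : nat) : bool :=
  (coefs (g * f ^+ (j - 1)) (i - 2) == 1 %[mod 2])%Z.

Definition riordan_adj : rel 'I_n := fun x y =>
  if (label y < label x)%N then riordan_lower (label x) (label y)
  else if (label x < label y)%N then riordan_lower (label y) (label x)
  else false.

Fact riordan_adj_sym : symmetric riordan_adj.
Proof. by move=> x y; rewrite /riordan_adj; case: ltngtP. Qed.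

Fact riordan_adj_irr : irreflexive riordan_adj.
Proof. by move=> x; rewrite /riordan_adj ltnn. Qed.

Definition riordan_graph : sgraph 'I_n := SGraph riordan_adj_sym riordan_adj_irr.

End Riordan.

Definition is_riordan_graph (n : nat) (G : sgraph 'I_n) : Prop :=
  exists g f : {fps int}, coefs f 0 = 0 /\ G = riordan_graph n g f.

Lemma label_rev_ord (n : nat) (i : 'I_n) : label (rev_ord i) = (n + 1 - label i)%N.
Proof. by rewrite /label /= addn1 subSS subnSK. Qed.

Section ReverseRelabeling.
Variables (n : nat) (G : sgraph 'I_n).

(* As [rev_ord] is an involution, x and y are adjacent after relabeling iff
   the vertices relabeled to x and y are adjacent in G. *)
Definition rev_adj : rel 'I_n := fun x y => adj G (rev_ord x) (rev_ord y).

Fact rev_adj_sym : symmetric rev_adj.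
Proof. by move=> x y; exact: adj_sym. Qed.

Fact rev_adj_irr : irreflexive rev_adj.
Proof. by move=> x; exact: adj_irr. Qed.

Definition reverse_relabeling : sgraph 'I_n := SGraph rev_adj_sym rev_adj_irr.

End ReverseRelabeling.

(* Main.v *)
Require Import Defs.
From mathcomp Require Import all_boot all_order all_algebra.
From mathcomp Require Import zify.
From mathcomp Require Import boolp classical_sets.
Import GRing.Theory.
Local Open Scope ring_scope.

(** Write h for the compositional inverse of f and q for the quotient t / h.
    The theorem holds already over the integers, as an identity between the
    coefficients that decide adjacency, before reduction modulo 2.  For labels
    i > j, reversal sends the pair (i, j) to (n+1-j, n+1-i), so with a = n - i
    and d = i - j - 1 the claim is
      [t^(a+d)] g f^a = [t^d] g(h) h' q^(a+d+1),
    the factor h^(j-1) having been absorbed by q^(n-1) through q h = t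
    ([coefs_riordan_reverse]).

    This is the invariance of the residue under the substitution t = h(s).
    Indeed [t^m] u is the residue of u(t) / t^(m+1), which becomes the residue
    of u(h) h' / h^(m+1), that is [s^m] (u(h) h' q^(m+1)); take u = g f^a, for
    which u(h) = g(h) s^a.  To avoid Laurent series, the substitution rule
    ([coefs_change_var]) is reduced by linearity to u = t^i, where it says that
    [s^k] (h' q^(k+1)), the residue of h' / h^(k+1), is 1 for k = 0 and 0
    otherwise ([coefs_residue_power]): the first is a logarithmic residue, and
    the second vanishes because h' / h^(k+1) is, up to the factor -k, the
    derivative of h^(-k).

    Composition with a series without constant term is a ring morphism and is
    associative; hence h exists, since f can be inverted on the left by solving
    a unitriangular system, and a left inverse with a left inverse of its own
    is two-sided ([compinvP]). *)

(** * Composition and derivation of formal power series *)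

Section FormalPowerSeries.
Set Implicit Arguments.
Unset Strict Implicit.
Variable R : comNzRingType.
Implicit Types (u v w f h : {fps R}) (k n : nat).

Local Notation X := (fpsX R).

Lemma coefsD u v k : coefs (u + v) k = coefs u k + coefs v k.
Proof. by []. Qed.

Lemma coefsM u v k :
  coefs (u * v) k = \sum_(i < k.+1) coefs u i * coefs v (k - i).
Proof. by []. Qed.

Lemma coefsM0 u v : coefs (u * v) 0 = coefs u 0 * coefs v 0.
Proof. by rewrite coefsM big_ord1. Qed.

Lemma coefsX0 u n : coefs (u ^+ n) 0 = coefs u 0 ^+ n.
Proof. by elim: n => [|n IHn] //; rewrite !exprS coefsM0 IHn. Qed.

Lemma coefsMn u n k : coefs (u *+ n) k = coefs u k *+ n.
Proof. by elim: n => [|n IHn] //; rewrite !mulrS coefsD IHn. Qed.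

Lemma coefs_fpsXM u k : coefs (X * u) k = if k is k'.+1 then coefs u k' else 0.
Proof.
rewrite coefsM big_ord_recl mul0r add0r.
case: k => [|k]; first by rewrite big_ord0.
rewrite big_ord_recl mul1r big1 ?addr0 ?subSS ?subn0 // => i _.
by rewrite mul0r.
Qed.

Lemma coefs_fpsXnM a u k :
  coefs (X ^+ a * u) k = if (k < a)%N then 0 else coefs u (k - a).
Proof.
elim: a k => [|a IHa] k; first by rewrite expr0 mul1r subn0.
by rewrite exprS -mulrA coefs_fpsXM; case: k => //.
Qed.

Lemma fpsXM_inj : injective (fun u => X * u).
Proof.
by move=> u v /fpsP uv; apply/fpsP => k; have := uv k.+1; rewrite !coefs_fpsXM.
Qed.

Definition fps_shift u : {fps R} := Fps (fun k => coefs u k.+1).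

Lemma fps_shiftK u : coefs u 0 = 0 -> u = X * fps_shift u.
Proof. by move=> u0; apply/fpsP => -[|k]; rewrite coefs_fpsXM. Qed.

Lemma coefs_exp_small u n k : coefs u 0 = 0 -> (k < n)%N -> coefs (u ^+ n) k = 0.
Proof. by move=> /fps_shiftK-> kn; rewrite exprMn coefs_fpsXnM kn. Qed.

Lemma coefs_exp_diag u n : coefs u 0 = 0 -> coefs (u ^+ n) n = coefs u 1 ^+ n.
Proof.
by move=> /fps_shiftK {1}->; rewrite exprMn coefs_fpsXnM ltnn subnn coefsX0.
Qed.

(** Any cutoff above k gives the same sum, so that sums arising from different
    coefficients can be given a common range and exchanged. *)
Lemma coefs_comp_wide N u w k : coefs w 0 = 0 -> (k < N)%N ->
  coefs (fps_comp u w) k = \sum_(i < N) coefs u i * coefs (w ^+ i) k.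
Proof.
move=> w0 kN /=; rewrite (big_ord_widen _ (fun i => coefs u i * coefs (w ^+ i) k) kN).
rewrite big_mkcond; apply: eq_bigr => i _.
by case: ltnP => // ki; rewrite coefs_exp_small ?mulr0.
Qed.

(** Linearity in u reduces a coefficient of u(w) v to the case of monomials u. *)
Lemma coefs_compM u w v k : coefs w 0 = 0 ->
  coefs (fps_comp u w * v) k = \sum_(i < k.+1) coefs u i * coefs (w ^+ i * v) k.
Proof.
move=> w0; rewrite coefsM.
under eq_bigr => i _ do rewrite (@coefs_comp_wide k.+1) // mulr_suml.
rewrite exchange_big; apply: eq_bigr => j _.
by rewrite coefsM mulr_sumr; apply: eq_bigr => i _; rewrite mulrA.
Qed.

Lemma fps_compM u v w : coefs w 0 = 0 ->
  fps_comp (u * v) w = fps_comp u w * fps_comp v w.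
Proof.
move=> w0; apply/fpsP => k; rewrite coefs_compM //.
(* Both sides are sums of u_a v_b [t^k] w^(a+b): the left one over a + b <= k,
   the right one over a, b <= k, where the extra terms vanish. *)
pose F a b := coefs u a * (coefs v b * coefs (w ^+ (a + b)) k).
transitivity (\sum_(i < k.+1) \sum_(a < k.+1 | (a < i.+1)%N) F a (i - a)%N).
  apply: eq_bigr => i _; rewrite mulr_suml -(big_ord_widen _ (fun a => F a (i - a)%N)) //.
  by apply: eq_bigr => a _; rewrite /F subnKC ?mulrA // -ltnS.
rewrite (exchange_big_dep xpredT) //; apply: eq_bigr => a _.
rewrite [w ^+ a * _]mulrC coefs_compM // mulr_sumr.
under [RHS]eq_bigr => b _ do rewrite -exprD addnC.
rewrite -(big_geq_mkord a k.+1 xpredT (fun i => F a (i - a)%N)).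
rewrite -[RHS](big_mkord xpredT (F a)).
rewrite -{1}[nat_of_ord a]add0n big_addn.
rewrite [RHS](big_cat_nat (n := k.+1 - a)) ?leq_subr //= [X in _ = _ + X]big_nat_cond.
rewrite [X in _ = _ + X]big1 ?addr0 => [|b /andP[/andP[ab _] _]]; last first.
  by rewrite /F coefs_exp_small ?mulr0 // -leq_subLR.
by apply: eq_bigr => b _; rewrite addnK.
Qed.

Lemma fps_comp1 w : fps_comp 1 w = 1.
Proof.
apply/fpsP => k /=; rewrite big_ord_recl mul1r big1 ?addr0 // => i _.
by rewrite mul0r.
Qed.

Lemma fps_compXn u n w : coefs w 0 = 0 ->
  fps_comp (u ^+ n) w = fps_comp u w ^+ n.
Proof.
move=> w0; elim: n => [|n IHn]; first exact: fps_comp1.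
by rewrite !exprS fps_compM // IHn.
Qed.

Lemma coefs_comp0 u w : coefs (fps_comp u w) 0 = coefs u 0.
Proof. by rewrite /= big_ord1 mulr1. Qed.

Lemma fps_comp_fpsXl w : coefs w 0 = 0 -> fps_comp X w = w.
Proof.
move=> w0; apply/fpsP => k; rewrite (@coefs_comp_wide k.+2) // 2!big_ord_recl.
by rewrite mul0r mul1r add0r big1 ?addr0 // => i _; rewrite mul0r.
Qed.

Lemma fps_comp_fpsXr u : fps_comp u X = u.
Proof.
apply/fpsP => k /=; rewrite big_ord_recr /= big1 ?add0r => [|i _].
  by rewrite coefs_exp_diag //= expr1n mulr1.
by rewrite -[X ^+ i]mulr1 coefs_fpsXnM ltnNge ltnW //= subn_eq0 leqNgt ltn_ord mulr0.
Qed.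

Lemma fps_compA u v w : coefs v 0 = 0 -> coefs w 0 = 0 ->
  fps_comp (fps_comp u v) w = fps_comp u (fps_comp v w).
Proof.
move=> v0 w0; apply/fpsP => k.
have vw0 : coefs (fps_comp v w) 0 = 0 by rewrite coefs_comp0.
rewrite [LHS](@coefs_comp_wide k.+1) // [RHS](@coefs_comp_wide k.+1) //.
under eq_bigr => i _ do rewrite (@coefs_comp_wide k.+1 u v) // mulr_suml.
rewrite exchange_big; apply: eq_bigr => j _.
rewrite -fps_compXn // (@coefs_comp_wide k.+1) // mulr_sumr.
by apply: eq_bigr => i _; rewrite mulrA.
Qed.

(** The matrix ([t^k] f^i) is triangular with unit diagonal, so the coefficients
    of v are determined one after the other.  The conclusion v'(0) = 1 lets the
    lemma be applied again, to v. *)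
Lemma ex_fps_comp_left_inv f : coefs f 0 = 0 -> coefs f 1 = 1 ->
  exists v, [/\ coefs v 0 = 0, coefs v 1 = 1 & fps_comp v f = X].
Proof.
move=> f0 f1.
pose Phi (c : nat -> R) k := coefs X k - \sum_(i < k) c i * coefs (f ^+ i) k.
(* The recursion is course-of-values: Phi c at k reads c below k only, so the
   iterates of Phi stabilize at k from the (k+1)-st on. *)
have PhiP N M k : (k < N)%N -> (k < M)%N ->
    iter N Phi (fun=> 0) k = iter M Phi (fun=> 0) k.
  elim: N M k => // N IHN [//|M] k kN kM; congr (_ - _).
  by apply: eq_bigr => i _; congr (_ * _); apply: IHN; apply: leq_trans (ltn_ord i) _.
pose v : {fps R} := Fps (fun k => iter k.+1 Phi (fun=> 0) k).
have vE k : coefs v k = coefs X k - \sum_(i < k) coefs v i * coefs (f ^+ i) k.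
  by congr (_ - _); apply: eq_bigr => i _; congr (_ * _); apply: PhiP.
have v0 : coefs v 0 = 0 by rewrite vE big_ord0 subr0.
exists v; split => //; first by rewrite vE big_ord1 v0 mul0r subr0.
apply/fpsP => k; rewrite /fps_comp [LHS]big_ord_recr coefs_exp_diag // f1.
by rewrite expr1n mulr1 vE; apply: subrKC.
Qed.

(** If v is a left inverse of f and w a left inverse of v, then
    w = w(v(f)) = f, so v is a right inverse as well. *)
Lemma compinvP f : coefs f 0 = 0 -> coefs f 1 = 1 -> is_compinv f (compinv f).
Proof.
move=> f0 f1; suff: exists v, is_compinv f v by move=> /xgetPex -/(_ 0).
have [v [v0 v1 vf]] := ex_fps_comp_left_inv f0 f1.
have [w [w0 _ wv]] := ex_fps_comp_left_inv v0 v1.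
exists v; split=> //.
suff -> : f = w by [].
by rewrite -[RHS]fps_comp_fpsXr -vf -fps_compA // wv fps_comp_fpsXl.
Qed.

(** Substituting h in f = t p gives t = h p(h), so the quotient exists. *)
Lemma fps_quo_compinvP f h : is_compinv f h -> fps_quo X h * h = X.
Proof.
case=> f0 h0 _ fh; rewrite /fps_quo.
suff: exists w, w * h = X by move=> /xgetPex -/(_ 0).
exists (fps_comp (fps_shift f) h).
by rewrite -fh {2}(fps_shiftK f0) fps_compM // fps_comp_fpsXl // mulrC.
Qed.

Lemma fps_derivM u v : fps_deriv (u * v) = fps_deriv u * v + u * fps_deriv v.
Proof.
(* The k-th coefficients only involve those of u and v up to index k+1, hence
   the rule follows from the one for polynomials. *)
apply/fpsP => k; rewrite coefsD.
have trunc w N : (fps_trunc N.+1 w)^`() = fps_trunc N (fps_deriv w).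
  by apply/polyP => i; rewrite coef_deriv !coef_poly ltnS; case: ifP; rewrite ?mul0rn.
pose P := fps_trunc k.+2 u; pose Q := fps_trunc k.+2 v.
transitivity ((P * Q)^`())`_k.
  by rewrite coef_deriv -coefs_mul_trunc.
rewrite derivM coefD !trunc; congr (_ + _); rewrite coefM; apply: eq_bigr => i _.
  by rewrite !coef_fps_trunc // ltnS (leq_trans (leq_subr _ _)).
by rewrite !coef_fps_trunc // ltnS ?leq_subr // ltnW.
Qed.

Lemma fps_derivX n u : fps_deriv (u ^+ n.+1) = u ^+ n * fps_deriv u *+ n.+1.
Proof.
elim: n => [|n IHn]; first by rewrite expr0 mul1r.
rewrite exprS fps_derivM IHn -mulrnAr mulrA -exprS [RHS]mulrS.
by rewrite mulrC mulrnAr.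
Qed.

Lemma fps_deriv1 : fps_deriv (1 : {fps R}) = 0.
Proof. by apply/fpsP => k /=; rewrite mul0rn. Qed.

Lemma fps_deriv_fpsX : fps_deriv X = 1.
Proof. by apply/fpsP => -[|k] //=; rewrite mul0rn. Qed.

End FormalPowerSeries.

(** * Change of variable in residues *)

Section ResidueChangeOfVariable.
Set Implicit Arguments.
Unset Strict Implicit.
Variable R : numDomainType.
Implicit Types (u h q : {fps R}) (m a d : nat).

Local Notation X := (fpsX R).

(** With r = h / s the inverse of q, the product rule for h = s r gives
    h' q^(m+1) = q^m - s q^(m-1) q' when m > 0, and m times this is
    m q^m - s (q^m)', whose coefficient at s^m is zero.  Dividing by m requires
    the absence of torsion. *)
Lemma coefs_residue_power h q m : coefs h 0 = 0 -> q * h = X ->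
  coefs (fps_deriv h * q ^+ m.+1) m = (m == 0)%N%:R.
Proof.
move=> /fps_shiftK; set r := fps_shift _ => hE qh.
have qr : q * r = 1.
  by apply: fpsXM_inj; rewrite /= mulr1 mulrCA -hE.
have dqr : fps_deriv r * q = - (fps_deriv q * r).
  apply/eqP; rewrite -addr_eq0 mulrC addrC -fps_derivM qr; apply/eqP.
  exact: fps_deriv1.
have dh : fps_deriv h = r + X * fps_deriv r.
  by rewrite {1}hE fps_derivM fps_deriv_fpsX mul1r.
case: m => [|m].
  by rewrite expr1 dh mulrDl coefsD -mulrA coefs_fpsXM addr0 mulrC qr.
have -> : fps_deriv h * q ^+ m.+2 = q ^+ m.+1 - X * (q ^+ m * fps_deriv q).
  rewrite dh exprS mulrDl mulrA [r * q]mulrC qr mul1r; congr (_ + _).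
  rewrite -mulrA -mulrN; congr (_ * _); rewrite mulrA dqr mulNr; congr (- _).
  by rewrite exprS -mulrA (mulrA r) [r * q]mulrC qr mul1r mulrC.
apply: (@Num.Theory.pmulrnI _ m.+1) => //; rewrite mul0rn -coefsMn mulrnBl -mulrnAr.
rewrite -fps_derivX coefsD coefsMn.
have -> v k : coefs (- v) k = - coefs v k by [].
by rewrite coefs_fpsXM subrr.
Qed.

(** Both sides are the residue of u(t) / t^(m+1), on the left after the
    substitution t = h(s). *)
Lemma coefs_change_var u h q m : coefs h 0 = 0 -> q * h = X ->
  coefs (fps_comp u h * (fps_deriv h * q ^+ m.+1)) m = coefs u m.
Proof.
move=> h0 qh; rewrite coefs_compM //.
have term i : (i <= m)%N ->
    coefs (h ^+ i * (fps_deriv h * q ^+ m.+1)) m = (m - i == 0)%N%:R.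
  move=> im; rewrite -(coefs_residue_power (m - i) h0 qh).
  have -> : h ^+ i * (fps_deriv h * q ^+ m.+1) =
            X ^+ i * (fps_deriv h * q ^+ (m - i).+1).
    rewrite -{1}(subnKC im) -addnS exprD -qh exprMn.
    by rewrite [fps_deriv h * _]mulrCA -[RHS]mulrA; apply: mulrCA.
  by rewrite coefs_fpsXnM ltnNge im.
rewrite big_ord_recr big1 => [|i _]; last first.
  rewrite (term i (ltnW (ltn_ord i))).
  by rewrite subn_eq0 leqNgt (ltn_ord i) mulr0.
by rewrite (term m (leqnn m)) subnn mulr1; apply: add0r.
Qed.

(** The change of variable for u = g f^a, with u(h) = g(h) t^a. *)
Lemma coefs_riordan_reverse g f h q a d : is_compinv f h -> q * h = X ->
  coefs (g * f ^+ a) (a + d) =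
  coefs (fps_comp g h * fps_deriv h * q ^+ (a + d).+1) d.
Proof.
move=> [f0 h0 _ fh] qh.
rewrite -(coefs_change_var _ _ h0 qh) fps_compM // fps_compXn // fh.
have -> : fps_comp g h * X ^+ a * (fps_deriv h * q ^+ (a + d).+1) =
          X ^+ a * (fps_comp g h * fps_deriv h * q ^+ (a + d).+1).
  by rewrite [_ * X ^+ a]mulrC -!mulrA.
by rewrite coefs_fpsXnM ltnNge leq_addr addKn.
Qed.

End ResidueChangeOfVariable.

(** * Reversal of Riordan graphs *)

Theorem theorem3p14 (n : nat) (g f : {fps int}) :
  coefs f 0 = 0 -> coefs (fps_deriv f) 0 = 1 ->
  let fbar := compinv f in
  let G' := reverse_relabeling (riordan_graph n g f) in
  is_riordan_graph G' /\
  G' = riordan_graph n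
         (fps_comp g fbar * fps_deriv fbar * fps_quo (fpsX int) fbar ^+ (n - 1))
         fbar.
Proof.
move=> f0 f1 fbar G'.
have compinv_f : is_compinv f fbar by apply: compinvP.
have [_ fbar0 _ _] := compinv_f.
have quo_fbar := fps_quo_compinvP compinv_f.
have G'E : G' = riordan_graph n
  (fps_comp g fbar * fps_deriv fbar * fps_quo (fpsX int) fbar ^+ (n - 1)) fbar.
  have lower (x y : 'I_n) : (label y < label x)%N ->
      riordan_lower g f (label (rev_ord y)) (label (rev_ord x)) =
      riordan_lower
        (fps_comp g fbar * fps_deriv fbar * fps_quo (fpsX int) fbar ^+ (n - 1))
        fbar (label x) (label y).
    rewrite !label_rev_ord /riordan_lower /label => yx.
    have xn := ltn_ord x.
    congr (_ == _ %[mod 2])%Z.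
    pose a := (n - x.+1)%N; pose d := (x - y.+1)%N.
    have -> : (n + 1 - x.+1 - 1 = a)%N by lia.
    have -> : (n + 1 - y.+1 - 2 = a + d)%N by lia.
    have -> : (n - 1 = (a + d).+1 + (y.+1 - 1))%N by lia.
    rewrite exprD -!mulrA -exprMn quo_fbar.
    rewrite !mulrA [_ * fpsX int ^+ _]mulrC coefs_fpsXnM.
    rewrite ifF; last by lia.
    have -> : (x.+1 - 2 - (y.+1 - 1) = d)%N by lia.
    exact: coefs_riordan_reverse.
  apply/sgraphP => x y; rewrite /= /rev_adj /= /riordan_adj !label_rev_ord.
  have [xn yn] : (label x <= n /\ label y <= n)%N by split; apply: ltn_ord.
  case: (ltngtP (label y) (label x)) => yx.
  - by rewrite -lower // !label_rev_ord ifF ?ifT //; lia.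
  - by rewrite -lower // !label_rev_ord ifT //; lia.
  - by rewrite yx !ltnn.
by split=> //; rewrite G'E; eexists _, fbar.
Qed.
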